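(* Let $d\ge 2$ and $r\in\mathbb{N}\setminus\{1,2,4\}$. There exists a shift-invariant Markov cocycle on $X_r$ which is given by a nearest neighbor interaction but not by a shift-invariant nearest neighbor interaction; that is, $$\mathcal{G}^\sigma_{X_r}\neq\mathcal{G}_{X_r}\cap\mathcal{M}^\sigma_{X_r}.$$
   Context: $\mathbb{Z}^d$ is regarded as the vertex set of the graph in which $n,m$ are adjacent iff $\|n-m\|_1=1$. For $F\subset\mathbb{Z}^d$, $\partial F$ is the set of sites outside $F$ adjacent to some site of $F$. The shift action is $(\sigma_n x)_m=x_{m+n}$. The space $X_r$: $Ht=\{\hat x\in\mathbb{Z}^{\mathbb{Z}^d}: |\hat x_n-\hat x_m|=1 \text{ whenever } \|n-m\|_1=1\}$; $\phi_r:Ht\to(\mathbb{Z}_r)^{\mathbb{Z}^d}$, $\mathbb{Z}_r=\mathbb{Z}/r\mathbb{Z}$, is coordinatewise reduction modulo $r$; and $X_r=\phi_r(Ht)$. $\Delta_X$ is the set of pairs $(x,y)\in X\times X$ with $x_n=y_n$ for all but finitely many $n$. A $\Delta_X$-cocycle is a function $M:\Delta_X\to\mathbb{R}$ with $M(x,z)=M(x,y)+M(y,z)$ whenever $(x,y),(y,z)\in\Delta_X$. It is a Markov cocycle if, for every finite $F$ and all $(x,y)\in\Delta_X$ with $x|_{F^c}=y|_{F^c}$, $M(x,y)$ is determined by $x|_{F\cup\partial F}$ and $y|_{F\cup\partial F}$. It is shift-invariant if $M(\sigma_n x,\sigma_n y)=M(x,y)$ for all $n$. $\mathcal{M}^\sigma_X$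 is the space of shift-invariant Markov cocycles. $\mathcal{B}(X)$ is the set of all patterns $x|_W$, $x\in X$, $W\subset\mathbb{Z}^d$ finite. A nearest neighbor interaction on $X$ is a function $\phi:\mathcal{B}(X)\to\mathbb{R}$ with $\phi(a)=0$ whenever the set on which $a$ is defined has diameter greater than $1$; it is shift-invariant if it takes the same value on a pattern and all its translates. The associated Gibbs cocycle is $M_\phi(x,y)=\sum_{W\text{ finite}}\big(\phi(y|_W)-\phi(x|_W)\big)$. $\mathcal{G}_X$ is the set of all $M_\phi$ with $\phi$ a nearest neighbor interaction on $X$, and $\mathcal{G}^\sigma_X$ is the set of all $M_\phi$ with $\phi$ a shift-invariant nearest neighbor interaction on $X$. *)

(* Defs.v *)
From HB Require Import structures.
From mathcomp Require Import all_boot all_order all_algebra.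
From mathcomp Require Import finmap.
From mathcomp Require Import boolp classical_sets cardinality fsbigop reals.

Set Implicit Arguments.
Unset Strict Implicit.
Unset Printing Implicit Defensive.

Import Order.TTheory GRing.Theory Num.Theory.

Local Open Scope classical_set_scope.
Local Open Scope ring_scope.

Notation site d := {ffun 'I_d -> int}.

Definition norm1 (d : nat) (n : site d) : nat := (\sum_(i < d) `|n i|)%N.

Definition adjacent (d : nat) (n m : site d) : Prop := norm1 (n - m) = 1%N.

Definition boundary (d : nat) (F : set (site d)) : set (site d) :=
  [set n | ~ F n /\ exists2 m, F m & adjacent n m].

Definition config (d : nat) (A : Type) : Type := site d -> A.

Definition shift_config (d : nat) (A : Type) (n : site d) (x : config d A) :
  config d A := fun m => x (m + n).

Definition agree_on (d : nat) (A : Type) (S : set (site d))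
  (x y : config d A) : Prop := forall n, S n -> x n = y n.

Definition Ht (d : nat) : set (config d int) :=
  [set x | forall n m, adjacent n m -> `|x n - x m| = 1].

(* 'Z_r is Z/rZ only when 1 < r. *)
Definition reduce (d r : nat) (x : config d int) : config d 'Z_r :=
  fun n => (x n)%:~R.

Definition Xr (d r : nat) : set (config d 'Z_r) := @reduce d r @` @Ht d.

Arguments Xr : clear implicits.

Section Cocycles.
Variables (R : realType) (d : nat) (A : Type) (X : set (config d A)).

Definition Delta : set (config d A * config d A) :=
  [set p | [/\ X p.1, X p.2 & finite_set [set n | p.1 n <> p.2 n]]].

(* A function on Delta takes arguments in the subtype of pairs in Delta;
   membership is boolean, so the value does not depend on its proof. *)
Definition dpair (x y : config d A) (xy : (x, y) \in Delta) : Delta :=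
  exist _ (x, y) xy.

Definition cocycle (M : Delta -> R) : Prop :=
  forall x y z (xy : (x, y) \in Delta) (yz : (y, z) \in Delta)
    (xz : (x, z) \in Delta), M (dpair xz) = M (dpair xy) + M (dpair yz).

Definition markov_cocycle (M : Delta -> R) : Prop :=
  forall F : set (site d), finite_set F ->
  forall x y x' y' (xy : (x, y) \in Delta) (xy' : (x', y') \in Delta),
    agree_on (~` F) x y -> agree_on (~` F) x' y' ->
    agree_on (F `|` boundary F) x x' -> agree_on (F `|` boundary F) y y' ->
    M (dpair xy) = M (dpair xy').

Definition shift_invariant_cocycle (M : Delta -> R) : Prop :=
  forall n x y (xy : (x, y) \in Delta)
    (sxy : (shift_config n x, shift_config n y) \in Delta),
    M (dpair sxy) = M (dpair xy).

Definition Markov_sigma : set (Delta -> R) :=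
  [set M | [/\ cocycle M, markov_cocycle M & shift_invariant_cocycle M]].

Definition pattern_on (x : config d A) (W : {fset site d}) :
  {fmap site d -> A} := [fmap n : W => x (val n)].

Definition patterns : set {fmap site d -> A} :=
  [set a | exists2 x, X x & exists W, a = pattern_on x W].

Lemma pattern_on_in (x : config d A) (W : {fset site d}) :
  X x -> pattern_on x W \in patterns.
Proof. by move=> Xx; apply/mem_set; exists x => //; exists W. Qed.

Definition pattern_of (x : config d A) (Xx : X x) (W : {fset site d}) :
  patterns := exist _ (pattern_on x W) (pattern_on_in W Xx).

Definition diam (W : {fset site d}) : nat :=
  (\max_(i : W) \max_(j : W) norm1 (val i - val j)%R)%N.

Definition nn_interaction (phi : patterns -> R) : Prop :=
  forall a : patterns, (1 < diam (domf (val a)))%N -> phi a = 0.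

(* Lookups return None outside the domain, so this also says that the domain
   of b is that of a translated by - n. *)
Definition translate_of (n : site d) (a b : {fmap site d -> A}) : Prop :=
  forall m, b.[? m]%fmap = a.[? m + n]%fmap.

Definition shift_invariant_interaction (phi : patterns -> R) : Prop :=
  forall n (a b : patterns), translate_of n (val a) (val b) -> phi a = phi b.

Lemma Delta_l (p : Delta) : X (val p).1.
Proof. by case: p => p /= /set_mem[]. Qed.

Lemma Delta_r (p : Delta) : X (val p).2.
Proof. by case: p => p /= /set_mem[]. Qed.

(* The sum is 0 by convention when infinitely many terms are nonzero. This
   does not occur for a nearest neighbor interaction, where only the finitely
   many W of diameter at most 1 that meet a difference site contribute. *)
Definition gibbs (phi : patterns -> R) (p : Delta) : R :=
  \sum_(W \in [set: {fset site d}])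
    (phi (pattern_of (Delta_r p) W) - phi (pattern_of (Delta_l p) W)).

Definition Gibbs : set (Delta -> R) := gibbs @` nn_interaction.

Definition Gibbs_sigma : set (Delta -> R) :=
  gibbs @` (nn_interaction `&` shift_invariant_interaction).

End Cocycles.

Arguments Markov_sigma R {d A} X.
Arguments Gibbs R {d A} X.
Arguments Gibbs_sigma R {d A} X.

(* Main.v *)
Require Import Defs.
From mathcomp Require Import all_boot all_order all_algebra.
From mathcomp Require Import finmap zify.
From mathcomp Require Import boolp classical_sets cardinality fsbigop reals.

Set Implicit Arguments.
Unset Strict Implicit.
Unset Printing Implicit Defensive.

Import Order.TTheory GRing.Theory Num.Theory.

Local Open Scope classical_set_scope.
Local Open Scope ring_scope.

(** The hypotheses leave [2 < r], so that the colours of two adjacent sites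
    determine the increment [+1] or [-1] of the height along the edge joining
    them. The cocycle that separates the two spaces is the total change of
    height, the sum over all sites [n] of [yh n - xh n], where [xh] and [yh] are
    lifts of [x] and [y] that agree off a finite set; such lifts exist because
    the complement of a box is connected when [2 <= d] ([constant_off_box]).

    Summation by parts rewrites it as the sum over [n] of [- n i] times the
    change of the increment along the edge from [n] to [n + unit_site i]; this
    is taken as the definition ([height_cocycle]). Each term depends on one edge
    only, so this is the Gibbs cocycle of a nearest neighbor interaction
    ([gibbs_slope_interaction]), whose weights [- n i] are not shift-invariant.
    The cocycle itself is shift-invariant: a translation adds a constant to the
    weights, and the changes of the increments sum to zero
    ([sum_slope_diff0]).

    No shift-invariant interaction gives this cocycle. Let all the neighbours of
    the origin carry the colour [a], and flip the origin from [a - 1] to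
    [a + 1]: the height changes by [2], for each of the [r] colours [a]. For a
    shift-invariant interaction, however, the flips sum to zero over [a]
    ([sum_gibbs_flip]): the site terms telescope around the cycle of colours,
    and so do the edge terms, after the two edges at the origin in opposite
    directions have been identified by a translation ([sum_star_valueN]). *)

(** * Sites, boxes and parity *)

Section Sites.
Variable d : nat.
Implicit Types (n m : site d) (i j : 'I_d).

Definition unit_site i : site d := [ffun j => (j == i)%:R].

Definition box (N : nat) : set (site d) :=
  [set n | forall i, (`|n i| <= N)%N].

Lemma finite_box N : finite_set (box N).
Proof.
pose f (g : {ffun 'I_d -> 'I_(N.*2.+1)}) : site d :=
  [ffun i => (g i : nat)%:Z - N%:Z].
apply: (@sub_finite_set _ _ (f @` setT)); last exact: finite_image.
move=> n nN; exists [ffun i => inord (absz (n i + N%:Z))] => //.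
apply/ffunP => i; rewrite !ffunE inordK; have /= := nN i; lia.
Qed.

Lemma finite_set_sub_box (F : set (site d)) :
  finite_set F -> exists N, F `<=` box N.
Proof.
case/finite_seqP => s ->; elim: s => [|n s [N IH]]; first by exists 0%N.
exists (maxn N (\max_i `|n i|)%N) => m /=; rewrite inE => /orP[/eqP->|ms] i.
  by rewrite leq_max (leq_bigmax i) orbT.
by rewrite leq_max (IH m ms i).
Qed.

Lemma norm10 : norm1 (0 : site d) = 0%N.
Proof. by rewrite /norm1 big1 // => i _; rewrite ffunE. Qed.

Lemma norm1_eq0 n : norm1 n = 0%N -> n = 0.
Proof.
move=> /eqP; rewrite /norm1 sum_nat_eq0 => /forallP n0.
by apply/ffunP => i; rewrite ffunE; apply/eqP; rewrite -absz_eq0; exact: n0.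
Qed.

Lemma norm1N n : norm1 (- n) = norm1 n.
Proof. by apply: eq_bigr => i _; rewrite ffunE abszN. Qed.

Lemma norm1_unit_site i : norm1 (unit_site i) = 1%N.
Proof.
rewrite /norm1 (bigD1 i) //= ffunE eqxx big1 // => j /negPf ji.
by rewrite ffunE ji.
Qed.

Lemma norm1_sub_box1 n : (norm1 n <= 1)%N -> box 1 n.
Proof. by move=> n1 i; apply: leq_trans n1; rewrite /norm1 (bigD1 i) ?leq_addr. Qed.

Lemma odd_abszD (a b : int) : odd (absz (a + b)) = odd (absz a) (+) odd (absz b).
Proof. rewrite -negb_eqb; lia. Qed.

Lemma odd_norm1D n m : odd (norm1 (n + m)) = odd (norm1 n) (+) odd (norm1 m).
Proof.
have E k : odd (norm1 k) = \big[addb/false]_(i < d) odd `|k i|%N.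
  by apply: (big_morph odd) => // a b; rewrite oddD.
rewrite !E -big_split; apply: eq_bigr => i _ /=; rewrite ffunE; exact: odd_abszD.
Qed.

Lemma odd_norm1B n m : odd (norm1 (n - m)) = odd (norm1 n) (+) odd (norm1 m).
Proof. by rewrite odd_norm1D norm1N. Qed.

(** In dimension at least two the complement of a box is connected: as long as
    one coordinate stays large, the others can be moved freely, so every outer
    site can be moved to the corner all of whose coordinates are [N + 1]. *)
Lemma constant_off_box T (v : site d -> T) (N : nat) i0 i1 :
  i0 != i1 ->
  (forall n i, ~ box N n -> ~ box N (n + unit_site i) ->
     v (n + unit_site i) = v n) ->
  exists c, forall n, ~ box N n -> v n = c.
Proof.
move=> i01 vstep.
pose upd n j (t : int) : site d := [ffun k => if k == j then t else n k].
have outside n i : (N < `|n i|)%N -> ~ box N n by rewrite ltnNge => /negP h /(_ i).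
have updS n j t : upd n j t + unit_site j = upd n j (t + 1).
  by apply/ffunP => k; rewrite !ffunE; case: eqP; rewrite ?addr0.
have upd_out n i j t : i != j -> (N < `|n i|)%N -> ~ box N (upd n j t).
  by move=> ij ni; apply: (@outside _ i); rewrite ffunE (negPf ij).
have upd0 n i j t : i != j -> (N < `|n i|)%N -> v (upd n j t) = v (upd n j 0).
  move=> ij ni.
  have vS s : v (upd n j (s + 1)) = v (upd n j s).
    by rewrite -updS; apply: vstep; rewrite ?updS; apply: upd_out ij ni.
  elim/int_rect: t => // k IH; first by rewrite -addn1 PoszD vS.
  by rewrite -[RHS]IH -(vS (- k.+1%:Z)); congr (v (upd _ _ _)); lia.
have move1 n m i j : i != j -> (N < `|n i|)%N ->
    (forall k, k != j -> n k = m k) -> v n = v m.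
  move=> ij ni nm.
  have updE p : upd p j (p j) = p by apply/ffunP => k; rewrite ffunE; case: eqP => [->|].
  rewrite -(updE n) -(updE m) (upd0 _ _ _ _ ij ni) (upd0 _ i) ?nm //; last by rewrite -nm.
  congr (v _); apply/ffunP => k; rewrite !ffunE; case: eqP => // /eqP; exact: nm.
have moves n m i : (N < `|n i|)%N -> n i = m i -> v n = v m.
  move=> ni nmi.
  (* the coordinates of n are replaced by those of m one at a time *)
  pose h (k : nat) : site d := [ffun j : 'I_d => if (j < k)%N then m j else n j].
  have hi k : h k i = n i by rewrite ffunE -nmi if_same.
  have vh k : v (h k) = v n.
    elim: k => [|k IH]; first by congr v; apply/ffunP => j; rewrite ffunE.
    rewrite -IH; have [kd|dk] := ltnP k d; last first.
      congr v; apply/ffunP => j; rewrite !ffunE ltnS.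
      by rewrite (leq_trans (ltnW (ltn_ord j)) dk) (leq_trans (ltn_ord j) dk).
    have [ik|ik] := eqVneq i (Ordinal kd).
      congr v; apply/ffunP => j; rewrite !ffunE ltnS leq_eqVlt.
      case: eqP => [jk|//]; have -> : j = i by apply: val_inj; rewrite ik.
      by rewrite nmi if_same.
    apply: (move1 _ _ _ _ ik); first by rewrite hi.
    move=> j jk; rewrite !ffunE ltnS leq_eqVlt.
    by case: eqP => // jk'; case/eqP: jk; apply: val_inj.
  rewrite -(vh d); congr v; apply/ffunP => j; by rewrite ffunE ltn_ord.
pose p : site d := [ffun=> N.+1%:Z]; exists (v p) => n nN.
have [i ni] : exists i, (N < `|n i|)%N.
  apply: contrapT => h; apply: nN => i; rewrite leqNgt; apply/negP => ni.
  by apply: h; exists i.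
have [j ij] : exists j, i != j.
  by have [->|] := eqVneq i i0; [exists i1|exists i0].
have ip k : (N < `|p k|)%N by rewrite ffunE.
rewrite (moves n [ffun k => if k == i then n i else p k] i ni) ?ffunE ?eqxx //.
apply: (moves _ _ j); rewrite ffunE eq_sym (negPf ij) //.
Qed.

End Sites.

(** * Finitely supported sums *)

Section FiniteSums.
Variables (R : realType) (d : nat).
Implicit Types (f g : site d -> R) (S : set (site d)).

Lemma fsum_linear (a : R) f g S : finite_set S ->
  (forall n, ~ S n -> f n = 0) -> (forall n, ~ S n -> g n = 0) ->
  \sum_(n \in [set: site d]) (f n + a * g n) =
  \sum_(n \in [set: site d]) f n + a * \sum_(n \in [set: site d]) g n.
Proof.
move=> finS f0 g0.
have W (h : site d -> R) : (forall n, ~ S n -> h n = 0) ->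
    \sum_(n \in [set: site d]) h n = \sum_(n \in S) h n.
  by move=> h0; apply/esym/fsbig_widen => // n [_ nS]; exact: h0.
rewrite !W // => [|n nS]; first by rewrite fsbig_split // mulr_fsumr.
by rewrite f0 ?g0 ?mulr0 ?addr0.
Qed.

Lemma fsum_translate (e : site d) f :
  \sum_(n \in [set: site d]) f (n + e) = \sum_(n \in [set: site d]) f n.
Proof.
apply/esym/(@reindex_fsbigT _ _ _ _ _ (fun n => n + e)).
by exists (fun n => n - e) => n; rewrite ?addrK ?subrK.
Qed.

Lemma finite_translate (e : site d) S :
  finite_set S -> finite_set [set n | S (n + e)].
Proof.
move=> finS; apply: (@sub_finite_set _ _ ((fun n => n - e) @` S)).
  by move=> n Sn; exists (n + e); rewrite ?addrK.
exact: finite_image.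
Qed.

Lemma fsum_difference0 (e : site d) f S : finite_set S ->
  (forall n, ~ S n -> f n = 0) ->
  \sum_(n \in [set: site d]) (f (n + e) - f n) = 0.
Proof.
move=> finS f0.
under eq_fsbigr do rewrite -[- f _]mulN1r.
rewrite (@fsum_linear (-1) _ _ (S `|` [set n | S (n + e)])).
- by rewrite fsum_translate mulN1r subrr.
- by rewrite finite_setU; split=> //; exact: finite_translate.
- by move=> n h; apply: f0 => Sn; apply: h; right.
- by move=> n h; apply: f0 => Sn; apply: h; left.
Qed.

End FiniteSums.
(** * Slopes and the height cocycle *)

Lemma natr2_Zp_neq0 r : (2 < r)%N -> 2%:R != 0 :> 'Z_r.
Proof.
move=> r2; apply/eqP => /(congr1 (fun a : 'Z_r => nat_of_ord a)).
by rewrite val_Zp_nat ?(ltnW r2) // modn_small.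
Qed.

Section HeightCocycle.
Variables (R : realType) (d r : nat).
Hypothesis r_gt2 : (2 < r)%N.
Local Notation X := (Xr d r).
Implicit Types (x y : config d 'Z_r) (n : site d) (i : 'I_d).

(** On [Xr d r] this is the height increment along the edge; the colours at its
    ends determine it, as [1] and [-1] are distinct modulo [r]. *)
Definition slope i x n : R := if x (n + unit_site i) == x n + 1 then 1 else -1.

Lemma slope_reduce i (xh : config d int) n : Ht xh ->
  slope i (reduce r xh) n = (xh (n + unit_site i) - xh n)%:~R.
Proof.
move=> Hx; rewrite /slope /reduce.
have := Hx (n + unit_site i) n; rewrite /adjacent.
rewrite [X in norm1 (X - _)]addrC addrK norm1_unit_site => /(_ erefl).
move: (xh (n + _)) (xh n) => b a ab.
have [->|->] : b = a + 1 \/ b = a - 1 by move: ab; lia.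
  by rewrite intrD eqxx addrC addKr.
rewrite [X in if X then _ else _](_ : _ = false); last first.
  apply/negP; rewrite intrD => /eqP/addrI/eqP; rewrite eq_sym -subr_eq0.
  by rewrite rmorphN opprK (negPf (natr2_Zp_neq0 r_gt2)).
by rewrite [a - 1]addrC addrK rmorphN1.
Qed.

Lemma slope_shift i x n k : slope i (shift_config k x) n = slope i x (n + k).
Proof. by rewrite /slope /shift_config addrAC. Qed.

Definition slope_diff i x y n : R := slope i y n - slope i x n.

Lemma slope_diff_off i x y n :
  ~ ([set m | x m <> y m] `|` [set m | x (m + unit_site i) <> y (m + unit_site i)]) n ->
  slope_diff i x y n = 0.
Proof.
move=> h; rewrite /slope_diff /slope.
have -> : x n = y n by apply: contrapT => xy; apply: h; left.
have -> : x (n + unit_site i) = y (n + unit_site i).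
  by apply: contrapT => xy; apply: h; right.
by rewrite subrr.
Qed.

Lemma finite_slope_diff i x y : finite_set [set m | x m <> y m] ->
  finite_set ([set m | x m <> y m] `|`
              [set m | x (m + unit_site i) <> y (m + unit_site i)]).
Proof.
move=> fin; rewrite finite_setU; split=> //.
exact: (@finite_translate _ (unit_site i) [set m | x m <> y m]).
Qed.

(** Lifts of two asymptotic points have the same increments away from a finite
    set, so by [constant_off_box] they differ by a constant off a box; the sum
    then telescopes. *)
Lemma sum_slope_diff0 (i0 i1 : 'I_d) x y : i0 != i1 -> X x -> X y ->
  finite_set [set m | x m <> y m] ->
  \sum_(n \in [set: site d]) slope_diff i0 x y n = 0.
Proof.
move=> i01 [xh Hx <-] [yh Hy <-] fin.
have [N FN] := finite_set_sub_box fin.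
pose v n : int := yh n - xh n.
have diffE i n : slope_diff i (reduce r xh) (reduce r yh) n =
    (v (n + unit_site i) - v n)%:~R.
  rewrite /slope_diff !slope_reduce // -intrB; congr intr.
  rewrite /v; lia.
have [c vc] : exists c, forall n, ~ box N n -> v n = c.
  apply: (constant_off_box i01) => n i nN neN.
  apply/eqP; rewrite -subr_eq0 -(intr_eq0 R) -diffE slope_diff_off //.
  by case=> /FN.
pose w n : R := (v n - c)%:~R.
have -> : \sum_(n \in [set: site d]) slope_diff i0 (reduce r xh) (reduce r yh) n
    = \sum_(n \in [set: site d]) (w (n + unit_site i0) - w n).
  apply: eq_fsbigr => n _; rewrite diffE /w -intrB; congr intr; lia.
apply: (@fsum_difference0 _ _ _ _ (box N)); first exact: finite_box.
by move=> n nN; rewrite /w vc // subrr.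
Qed.

(** By parts, this is the sum over [n] of the change of height at [n], for lifts
    that agree off a finite set: the weights [- n i] have gradient [-1] in
    direction [i]. *)
Definition height_cocycle i (p : Delta X) : R :=
  \sum_(n \in [set: site d]) - (n i)%:~R * slope_diff i (val p).1 (val p).2 n.

Lemma height_cocycle_cocycle i : cocycle (height_cocycle i).
Proof.
move=> x y z xy yz xz; rewrite /height_cocycle /=.
have /set_mem[_ _ /= fxy] := xy; have /set_mem[_ _ /= fyz] := yz.
rewrite -[X in _ = _ + X]mul1r -(@fsum_linear _ _ _ _ _
  (([set m | x m <> y m] `|` [set m | x (m + unit_site i) <> y (m + unit_site i)]) `|`
   ([set m | y m <> z m] `|` [set m | y (m + unit_site i) <> z (m + unit_site i)]))).
- apply: eq_fsbigr => n _; rewrite mul1r -mulrDr; congr (_ * _).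
  by rewrite /slope_diff [RHS]addrC addrA subrK.
- by rewrite finite_setU; split; exact: finite_slope_diff.
- by move=> n h; rewrite slope_diff_off ?mulr0 // => h'; apply: h; left.
- by move=> n h; rewrite slope_diff_off ?mulr0 // => h'; apply: h; right.
Qed.

Lemma adjacent_unit_site n i : adjacent (n + unit_site i) n.
Proof. by rewrite /adjacent [n + _]addrC addrK norm1_unit_site. Qed.

Lemma adjacentC n m : adjacent n m -> adjacent m n.
Proof. by rewrite /adjacent -norm1N opprB. Qed.

Lemma height_cocycle_markov i : markov_cocycle (height_cocycle i).
Proof.
move=> F finF x y x' y' xy xy' Fxy Fxy' Fx Fy.
rewrite /height_cocycle /=; apply: eq_fsbigr => n _; congr (_ * _).
have [FnF|] := pselect (F n \/ F (n + unit_site i)).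
  have [Fn Fe] : (F `|` boundary F) n /\ (F `|` boundary F) (n + unit_site i).
    split; [have [?|nF] := pselect (F n)|have [?|nF] := pselect (F (n + unit_site i))];
      try (by left); case: FnF => // Fm; right; split=> //.
      by exists (n + unit_site i) => //; apply/adjacentC/adjacent_unit_site.
    by exists n => //; exact: adjacent_unit_site.
  by rewrite /slope_diff /slope !Fx ?Fy.
move=> /not_orP[nF eF].
by rewrite /slope_diff /slope !(Fxy n, Fxy (n + _), Fxy' n, Fxy' (n + _)) // !subrr.
Qed.

(** Translating by [k] changes the weights by the constant [k i], which
    multiplies a sum that vanishes by [sum_slope_diff0]. *)
Lemma height_cocycle_shift (i i1 : 'I_d) : i != i1 ->
  shift_invariant_cocycle (height_cocycle i).
Proof.
move=> ii1 k x y xy sxy; rewrite /height_cocycle /=.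
have /set_mem[/= Xx Xy fxy] := xy.
have <- := @fsum_translate R d k
  (fun n => - (n i)%:~R * slope_diff i x y n).
have Sk0 : - (k i)%:~R * \sum_(n \in [set: site d]) slope_diff i x y (n + k) = 0.
  by rewrite (fsum_translate k (slope_diff i x y)) (sum_slope_diff0 ii1) ?mulr0.
rewrite -[LHS]addr0 -[X in _ + X = _]Sk0.
pose S := [set m | x m <> y m] `|` [set m | x (m + unit_site i) <> y (m + unit_site i)].
rewrite -(@fsum_linear _ _ _ _ _ [set n | S (n + k)]).
- apply: eq_fsbigr => n _.
  by rewrite /slope_diff !slope_shift ffunE intrD opprD mulrDl.
- exact/finite_translate/finite_slope_diff.
- by move=> n h; rewrite /slope_diff !slope_shift [_ - _](@slope_diff_off i x y) ?mulr0.
- by move=> n h; rewrite slope_diff_off.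
Qed.

Lemma height_cocycle_Markov_sigma (i i1 : 'I_d) : i != i1 ->
  Markov_sigma R X (height_cocycle i).
Proof.
move=> ii1; split; first exact: height_cocycle_cocycle.
  exact: height_cocycle_markov.
exact: height_cocycle_shift ii1.
Qed.

End HeightCocycle.

(** * Interactions and patterns *)

Section Patterns.
Variables (d : nat) (A : Type).
Implicit Types (x y : config d A) (W : {fset site d}) (n m : site d).

Lemma fnd_pattern_on x W m :
  (pattern_on x W).[? m]%fmap = if m \in W then Some (x m) else None.
Proof.
by case: ifPn => mW; [rewrite (in_fnd (mW : m \in domf _)) ffunE|rewrite not_fnd].
Qed.

Lemma eq_pattern_on x y W : (forall m, m \in W -> x m = y m) ->
  pattern_on x W = pattern_on y W.
Proof.
by move=> xy; apply/fmapP => m; rewrite !fnd_pattern_on; case: ifP => // /xy ->.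
Qed.

Lemma norm1_le_diam W n m : n \in W -> m \in W -> (norm1 (n - m)%R <= diam W)%N.
Proof.
move=> nW mW; rewrite /diam.
apply: leq_trans (leq_bigmax [` nW]%fset).
exact: (leq_bigmax [` mW]%fset).
Qed.

Lemma diam_le W (k : nat) :
  (forall n m, n \in W -> m \in W -> (norm1 (n - m)%R <= k)%N) -> (diam W <= k)%N.
Proof.
move=> Wk; apply/bigmax_leqP => i _; apply/bigmax_leqP => j _.
by apply: Wk; exact: fsvalP.
Qed.

(** The lattice is bipartite, hence triangle-free: a set of diameter at most
    one is a site or an edge. *)
Lemma diam_le1_star W : 0 \in W -> (diam W <= 1)%N ->
  exists2 e : site d, (norm1 e <= 1)%N & W = [fset 0; e]%fset.
Proof.
move=> W0 W1.
have dist n m : n \in W -> m \in W -> (norm1 (n - m)%R <= 1)%N.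
  by move=> nW mW; apply: leq_trans W1; exact: norm1_le_diam.
have norm_le n : n \in W -> (norm1 n <= 1)%N by move=> /dist/(_ W0); rewrite subr0.
have [[e [eW e0]]|all0] := pselect (exists e, e \in W /\ e != 0); last first.
  exists 0; first by rewrite norm10.
  apply/fsetP => m; rewrite !inE orbb; apply/idP/eqP => [mW|-> //].
  by apply/eqP/negPn/negP => m0; apply: all0; exists m.
exists e; first exact: norm_le.
have odd1 n : n \in W -> n != 0 -> odd (norm1 n).
  move=> nW; apply: contraR => nn; apply/eqP/norm1_eq0; move: nn (norm_le _ nW).
  by case: (norm1 n) => [|[|?]].
apply/fsetP => m; rewrite !inE; apply/idP/orP => [mW|[]/eqP -> //].
have [->|m0] := eqVneq m 0; [by left|right].
rewrite -subr_eq0; apply/eqP/norm1_eq0; have := dist _ _ mW eW.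
have : ~~ odd (norm1 (m - e)) by rewrite odd_norm1B !odd1.
by case: (norm1 (m - e)) => [|[|?]].
Qed.

Lemma diam_pair n m : (norm1 (n - m)%R <= 1)%N -> (diam [fset n; m]%fset <= 1)%N.
Proof.
move=> nm; apply: diam_le => a b; rewrite !inE.
by move=> /orP[]/eqP -> /orP[]/eqP ->; rewrite ?subrr ?norm10 // -norm1N opprB.
Qed.

Variables (R : realType) (X : set (config d A)).

(** Extending an interaction by zero to all finite maps dispenses with the
    proofs that a restriction of a configuration is a pattern of [X]. *)
Definition extend (phi : patterns X -> R) (a : {fmap site d -> A}) : R :=
  if insub a is Some p then phi p else 0.

Lemma extendE phi x W (Xx : X x) :
  extend phi (pattern_on x W) = phi (pattern_of Xx W).
Proof.
rewrite /extend (insubT (fun a => a \in patterns X) (pattern_on_in W Xx)).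
by congr phi; apply: val_inj.
Qed.

Lemma gibbsE phi (p : Delta X) : gibbs phi p =
  \sum_(W \in [set: {fset site d}])
    (extend phi (pattern_on (val p).2 W) - extend phi (pattern_on (val p).1 W)).
Proof.
apply: eq_fsbigr => W _.
by rewrite (extendE _ _ (Delta_l p)) (extendE _ _ (Delta_r p)).
Qed.

Lemma extend_nn phi x W : nn_interaction phi -> (1 < diam W)%N ->
  extend phi (pattern_on x W) = 0.
Proof.
move=> nn W1; rewrite /extend; case: insubP => // a _ aE.
by apply: nn; rewrite aE.
Qed.

Lemma extend_shift phi n x y W V : shift_invariant_interaction phi ->
  X x -> X y -> (forall m, (m \in V) = (m + n \in W)) ->
  (forall m, m \in V -> y m = x (m + n)) ->
  extend phi (pattern_on x W) = extend phi (pattern_on y V).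
Proof.
move=> inv Xx Xy VW xy; rewrite !(extendE _ _ Xx) !(extendE _ _ Xy).
apply: (inv n) => m /=; rewrite !fnd_pattern_on VW.
by case: ifP => // mW; rewrite xy // VW.
Qed.

(** Only the sets of diameter at most one that contain the origin see a change
    at the origin. *)
Lemma gibbs_single_site phi (p : Delta X) : nn_interaction phi ->
  (forall n, n != 0 -> (val p).1 n = (val p).2 n) ->
  gibbs phi p = \sum_(e \in [set e : site d | (norm1 e <= 1)%N])
    (extend phi (pattern_on (val p).2 [fset 0; e]%fset) -
     extend phi (pattern_on (val p).1 [fset 0; e]%fset)).
Proof.
move=> nn xy; rewrite gibbsE.
rewrite -(@fsbig_image _ _ _ _ _ [set e : site d | (norm1 e <= 1)%N]
  (fun e : site d => [fset 0; e]%fset)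
  (fun W => extend phi (pattern_on (val p).2 W) - extend phi (pattern_on (val p).1 W))).
  apply/esym/fsbig_widen => // W [_ Wne] /=.
  have [W1|W1] := ltnP 1 (diam W); first by rewrite !extend_nn // subrr.
  have [W0|W0] := boolP (0 \in W).
    by have [e e1 WE] := diam_le1_star W0 W1; case: Wne; exists e.
  rewrite (@eq_pattern_on (val p).1 (val p).2) ?subrr // => m mW.
  by apply: xy; apply: contraNneq W0 => <-.
move=> e e' _ _ /fsetP ee'.
have := ee' e; have := ee' e'; rewrite !inE !eqxx !orbT.
by case/orP => /eqP; [move=> -> /esym|move=> ->//]; rewrite orbb => /eqP.
Qed.

End Patterns.
(** * The height cocycle is a Gibbs cocycle *)

Section SlopeInteraction.
Variables (R : realType) (d r : nat).
Local Notation X := (Xr d r).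
Variable i : 'I_d.
Local Notation edge n := [fset n; (n + unit_site i)%R]%fset.

Lemma edge_inj : injective (fun n : site d => edge n).
Proof.
move=> n m /fsetP nm.
have := nm n; have := nm m; rewrite !inE !eqxx /=.
case/orP => [/eqP -> //|/eqP mn] /esym/orP[/eqP //|/eqP nm'].
have : (0 : site d) i = (unit_site i + unit_site i) i.
  by congr (fun_of_fin _ i); apply: (addrI n); rewrite addr0 addrA -mn -nm'.
by rewrite !ffunE eqxx.
Qed.

Definition edge_slope (a b : option 'Z_r) : R :=
  if b == omap (fun c => c + 1) a then 1 else -1.

(** The sum has a term only when the domain of the pattern is an edge in
    direction [i], and then just the one of its initial site [n]. *)
Definition slope_interaction (p : patterns X) : R :=
  \sum_(n \in [set n : site d | domf (val p) = edge n])
    - (n i)%:~R * edge_slope (val p).[? n]%fmap (val p).[? (n + unit_site i)%R]%fmap.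

Lemma slope_interaction_nn : nn_interaction slope_interaction.
Proof.
move=> p p1; rewrite /slope_interaction fsbig1 // => n /= pE.
suff: ~~ (1 < diam (domf (val p)))%N by rewrite p1.
rewrite [domf _]pE -leqNgt diam_pair // opprD addrA subrr add0r norm1N.
by rewrite norm1_unit_site.
Qed.

Lemma slope_interaction_edge x (Xx : X x) n :
  slope_interaction (pattern_of Xx (edge n)) = - (n i)%:~R * slope R i x n.
Proof.
rewrite /slope_interaction /= (_ : [set m | _] = [set n]).
  by rewrite fsbig_set1 !fnd_pattern_on !inE !eqxx orbT.
by apply/seteqP; split=> [m /edge_inj|m ->].
Qed.

Lemma slope_interaction_other x (Xx : X x) W :
  ~ range (fun n : site d => edge n) W ->
  slope_interaction (pattern_of Xx W) = 0.
Proof.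
move=> WE; rewrite /slope_interaction fsbig1 // => n /= nE.
by case: WE; exists n.
Qed.

Lemma gibbs_slope_interaction :
  gibbs slope_interaction = @height_cocycle R d r i.
Proof.
apply/funext => p; rewrite /gibbs /height_cocycle.
rewrite -(@fsbig_widen _ _ _ _ (range (fun n : site d => edge n))) //; last first.
  by move=> W [_ WE] /=; rewrite !slope_interaction_other // subrr.
rewrite fsbig_image; last by move=> n m _ _; exact: edge_inj.
by apply: eq_fsbigr => n _; rewrite !slope_interaction_edge -mulrBr.
Qed.

Lemma height_cocycle_Gibbs : Gibbs R X (@height_cocycle R d r i).
Proof.
exists slope_interaction; first exact: slope_interaction_nn.
exact: gibbs_slope_interaction.
Qed.

End SlopeInteraction.

(** * Flips of a chessboard configuration *)

Section Flips.
Variables (d : nat).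

(** Passing from [t = a - 1] to [t = a + 1] is the elementary local move of
    height functions, raising a local minimum at the origin to a local
    maximum. *)
Definition flip (A : pzRingType) (a t : A) : config d A :=
  fun n => if odd (norm1 n) then a else if n == 0 then t else a - 1.

Definition chessboard (A : Type) (a b : A) : config d A :=
  fun n => if odd (norm1 n) then a else b.

Lemma flip_Ht (a t : int) : `|t - a| = 1 -> Ht (flip a t).
Proof.
move=> ta n m nm.
have : odd (norm1 n) (+) odd (norm1 m) by rewrite -odd_norm1B nm.
rewrite /flip; case: (odd (norm1 n)); case: (odd (norm1 m)) => // _.
  by case: eqP => _; rewrite distrC // addrAC subrr.
by case: eqP => _ //; rewrite addrAC subrr.
Qed.

Lemma chessboard_Ht (a b : int) : `|b - a| = 1 -> Ht (chessboard a b).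
Proof.
move=> ab n m nm.
have : odd (norm1 n) (+) odd (norm1 m) by rewrite -odd_norm1B nm.
rewrite /chessboard; case: (odd (norm1 n)); case: (odd (norm1 m)) => // _.
by rewrite distrC.
Qed.

Variable r : nat.
Local Notation X := (Xr d r).
Implicit Types (a : 'Z_r) (e : site d).

Lemma flip_Xr a (s : int) : `|s| = 1 -> X (flip a (a + s%:~R)).
Proof.
move=> s1; exists (flip ((a : nat)%:Z) ((a : nat)%:Z + s)).
  by apply: flip_Ht; rewrite addrC addKr.
apply/funext => n; rewrite /reduce /flip.
by case: ifP => _; [|case: ifP => _]; rewrite ?intrD ?rmorphN1 -?pmulrn natr_Zp.
Qed.

Lemma chessboard_Xr a (s : int) : `|s| = 1 -> X (chessboard a (a + s%:~R)).
Proof.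
move=> s1; exists (chessboard ((a : nat)%:Z) ((a : nat)%:Z + s)).
  by apply: chessboard_Ht; rewrite addrC addKr.
apply/funext => n; rewrite /reduce /chessboard.
by case: ifP => _; rewrite ?intrD -?pmulrn natr_Zp.
Qed.

Lemma flip_Delta a : (flip a (a - 1), flip a (a + 1)) \in Delta X.
Proof.
apply/mem_set; split=> /=.
- by have := @flip_Xr a (-1) erefl; rewrite rmorphN1.
- exact: (@flip_Xr a 1).
- apply: (@sub_finite_set _ _ [set 0]); last exact: finite_set1.
  move=> n /=; rewrite /flip; case: ifP => // _.
  by case: eqP.
Qed.

Definition flip_pair a : Delta X := dpair (flip_Delta a).

Variable R : realType.

(** With edges in direction [i], the two edges at the origin start at the
    origin, with weight [0], and at its predecessor, with weight [1]. *)
Lemma height_cocycle_flip i a : (2 < r)%N ->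
  @height_cocycle R d r i (flip_pair a) = 2%:R.
Proof.
move=> r2; rewrite /height_cocycle /=.
rewrite -(@fsbig_widen _ _ _ _ [set - unit_site i]) //; last first.
  move=> n [_ /= ne].
  have [->|/eqP n0] := eqVneq n 0; first by rewrite ffunE oppr0 mul0r.
  rewrite slope_diff_off ?mulr0 // => -[]; rewrite /= /flip.
    by rewrite (introF eqP n0).
  rewrite (introF eqP) // => ni; apply: ne.
  by apply/eqP; rewrite -addr_eq0 ni.
rewrite fsbig_set1 /slope_diff /slope /flip addNr norm1N norm1_unit_site norm10 /=.
rewrite !ffunE eqxx !eqxx ifF ?mulrN1z ?opprK ?mul1r //.
apply/negP => /eqP /addrI /eqP; rewrite eq_sym -subr_eq0 opprK.
by rewrite (negPf (natr2_Zp_neq0 r2)).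
Qed.

Section ShiftInvariant.
Variable phi : patterns X -> R.
Hypotheses (phi_nn : nn_interaction phi) (phi_inv : shift_invariant_interaction phi).

Definition star_value e (a b : 'Z_r) : R :=
  extend phi (pattern_on (chessboard a b) [fset 0; e]%fset).

Lemma gibbs_flip a : gibbs phi (flip_pair a) =
  \sum_(e \in [set e : site d | (norm1 e <= 1)%N])
    (star_value e a (a + 1) - star_value e a (a - 1)).
Proof.
rewrite gibbs_single_site //; last first.
  by move=> n /negPf n0; rewrite /= /flip n0.
apply: eq_fsbigr => e; rewrite inE /= => e1.
have E t : pattern_on (flip a t) [fset 0; e]%fset =
           pattern_on (chessboard a t) [fset 0; e]%fset.
  apply: eq_pattern_on => m; rewrite !inE /flip /chessboard => /orP[]/eqP ->.
    by rewrite norm10 eqxx.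
  case: ifPn => // en; case: eqP => // e0; case: e0; apply: norm1_eq0.
  by move: en e1; case: (norm1 e) => [|[|?]].
by rewrite !E.
Qed.

(** For [e != 0], after a shift of the colour [a] on the left, both patterns
    carry [a] at the first end of an edge and [a + 1] at the second, the edge
    running from [0] to [e] on the left and from [- e] to [0] on the right: they
    are translates of each other. For [e = 0] only the colour of the origin
    matters and it runs through all colours on both sides. *)
Lemma sum_star_valueN e : (norm1 e <= 1)%N ->
  \sum_(a : 'Z_r) star_value e a (a - 1) =
  \sum_(a : 'Z_r) star_value (- e) a (a + 1).
Proof.
move=> e1; have [->|e0] := eqVneq e 0.
  have site0 a b c : star_value 0 a c = star_value 0 b c.
    congr (extend _ _); apply: eq_pattern_on => m.
    by rewrite !inE orbb => /eqP ->; rewrite /chessboard norm10.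
  under eq_bigr => a _ do rewrite (site0 _ 0).
  rewrite oppr0; under [RHS]eq_bigr => a _ do rewrite (site0 _ 0).
  rewrite (reindex_inj (addIr (1 : 'Z_r))) (reindex_inj (addIr (1 : 'Z_r))) /=.
  by apply: eq_bigr => a _; rewrite addrK.
rewrite (reindex_inj (addIr (1 : 'Z_r))) /=; apply: eq_bigr => a _; rewrite addrK.
have oe : odd (norm1 e).
  apply: contraR e0 => en; apply/eqP/norm1_eq0.
  by move: en e1; case: (norm1 e) => [|[|?]].
rewrite /star_value; apply: (extend_shift (n := e) phi_inv).
- by have := @chessboard_Xr (a + 1) (-1) erefl; rewrite rmorphN1 addrK.
- exact: (@chessboard_Xr a 1).
- move=> m; rewrite !inE orbC addr_eq0; congr (_ || _).
  by rewrite -[RHS]subr_eq0 addrK.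
- by move=> m _; rewrite /chessboard odd_norm1D oe addbT; case: odd.
Qed.

Lemma sum_gibbs_flip : \sum_(a : 'Z_r) gibbs phi (flip_pair a) = 0.
Proof.
have finS : finite_set [set e : site d | (norm1 e <= 1)%N].
  by apply: (@sub_finite_set _ _ (box 1)); [exact: norm1_sub_box1|exact: finite_box].
under eq_bigr do rewrite gibbs_flip fsbig_finite //.
rewrite exchange_big /= -fsbig_finite //.
pose f (e : site d) : R := \sum_(a : 'Z_r) star_value e a (a + 1).
have -> : \sum_(e \in [set e : site d | (norm1 e <= 1)%N])
    \sum_a (star_value e a (a + 1) - star_value e a (a - 1)) =
    \sum_(e \in [set e : site d | (norm1 e <= 1)%N]) (f e + - f (- e)).
  apply: eq_fsbigr => e; rewrite inE => e1.
  by rewrite big_split /= sumrN sum_star_valueN.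
rewrite fsbig_split //=.
rewrite (@reindex_fsbig _ _ _ _ _ (fun e : site d => - e)
  [set e : site d | (norm1 e <= 1)%N] [set e : site d | (norm1 e <= 1)%N] f).
  by rewrite -fsbig_split //= fsbig1 // => e _; rewrite subrr.
split=> [e|e e' _ _ /oppr_inj //|e e1]; first by rewrite /= norm1N.
by exists (- e); rewrite ?opprK //= norm1N.
Qed.

End ShiftInvariant.

Lemma height_cocycle_nGibbs_sigma i : (2 < r)%N ->
  ~ Gibbs_sigma R X (@height_cocycle R d r i).
Proof.
move=> r2 [phi [phi_nn phi_inv] phiE].
have := sum_gibbs_flip phi_nn phi_inv; rewrite phiE.
under eq_bigr do rewrite height_cocycle_flip //.
by move/eqP; rewrite sumr_const card_ord -mulrnA pnatr_eq0.
Qed.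

End Flips.

Theorem corollary5p6 (R : realType) (d r : nat) (hd : (2 <= d)%N)
  (hr0 : (0 < r)%N) (hr : r \notin [:: 1; 2; 4]%N) :
  (exists M : Delta (Xr d r) -> R,
     [/\ Markov_sigma R (Xr d r) M, Gibbs R (Xr d r) M &
         ~ Gibbs_sigma R (Xr d r) M]) /\
  Gibbs_sigma R (Xr d r) <> Gibbs R (Xr d r) `&` Markov_sigma R (Xr d r).
Proof.
have r2 : (2 < r)%N by move: hr0 hr; case: r => [|[|[|]]].
pose i0 : 'I_d := Ordinal (ltnW hd); pose i1 : 'I_d := Ordinal hd.
have M_markov := @height_cocycle_Markov_sigma R d r r2 i0 i1 isT.
have M_gibbs := @height_cocycle_Gibbs R d r i0.
have M_nsigma := @height_cocycle_nGibbs_sigma d r R i0 r2.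
split; first by exists (@height_cocycle R d r i0).
by move=> E; apply: M_nsigma; rewrite E.
Qed.
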